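(* Let $d\in\mathbb N$, $\mu\in\mathbb R^d$, let $\Sigma\in\mathbb R^{d\times d}$ be symmetric positive definite, let $X=(X^1,\dots,X^d)\sim N_d(\mu,\Sigma)$ with $X^i\in L$ for all $i$, let $r\in(-1,\infty)$, and let $\bar S$ be the market with $S^0_0=\dots=S^d_0=1$, $S^0_1=1+r$, $S^i_1=1+r+X^i$ for $i=1,\dots,d$. Let $0<b\le a\le1$ and $u(y)=y^a$ for $y\ge0$, $u(y)=-(-y)^b$ for $y<0$. Let $\Phi$ and $\varphi$ denote the standard normal distribution function and density, and put $\mathrm{SR}_{\max}(X):=\sup_{\pi\in\mathbb R^d\setminus\{\mathbf 0\}}\frac{\pi^\top\mu}{\sqrt{\pi^\top\Sigma\pi}}=\sqrt{\mu^\top\Sigma^{-1}\mu}$. Then: (a) For $\alpha\in(0,1/2)$ and $\mathcal R=\mathrm{VaR}^\alpha$: $(\mathcal E_u,\mathcal R)$-terminal-wealth portfolio selection is well posed for $\bar S$ if and only if $\mathrm{SR}_{\max}(X)<-\Phi^{-1}(\alpha)$, and it is weakly well posed for $\bar S$ if and only if $\mathrm{SR}_{\max}(X)<-\Phi^{-1}(\alpha)$. (b) For $\alpha\in(0,1)$ and $\mathcal R=\mathrm{ES}^\alpha$: $(\mathcal E_u,\mathcal R)$-terminal-wealth portfolio selection is well posed for $\bar S$ if and only if $\mathrm{SR}_{\max}(X)<\varphi(\Phi^{-1}(\alpha))/\alpha$, and it is weakly well posed for $\bar S$ if and only if $\mathrm{SR}_{\max}(X)<\varphi(\Phi^{-1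}(\alpha))/\alpha$.
   Context: Setting. $(\Omega,\mathcal F,\mathbb P)$ is an atomless probability space. $L$ is a Riesz space of random variables (vector lattice for the $\mathbb P$-a.s. order) with $L^\infty\subset L\subset L^1$, which is law-invariant: if $Y\in L$ and $Z$ is a random variable on $(\Omega,\mathcal F,\mathbb P)$ with the same law as $Y$, then $Z\in L$. Expected utility: $\mathcal E_u:L\to[-\infty,\infty)$, $\mathcal E_u(Y)=\mathbb E[u(Y)]$; here $\mathcal E_u(\infty):=\lim_{y\to\infty}u(y)=\infty$. Risk functionals, for $Y\in L$ and $\alpha\in(0,1)$: $\mathrm{VaR}^\alpha(Y):=\inf\{m\in\mathbb R:\mathbb P[m+Y<0]\le\alpha\}$ and $\mathrm{ES}^\alpha(Y):=\frac1\alpha\int_0^\alpha\mathrm{VaR}^\beta(Y)\,d\beta$. Problem. For $w\in(0,\infty)$ and $R_{\max}\in[\mathcal R(w(1+r)),\infty)$, $(\mathcal E_u,\mathcal R)$-terminal-wealth portfolio selection is: maximize $\mathcal E_u(\bar\theta\cdot\bar S_1)$ over $\bar\theta\in\mathbb R^{1+d}$ with $\bar\theta\cdot\bar S_0=w$ and $\mathcal R(\bar\theta\cdot\bar S_1)\le R_{\max}$. It is well posed for $\bar S$ if for every such $w$ and $R_{\max}$ a maximizer exists; it is weakly well posed for $\bar S$ if for every such $w$ and $R_{\max}$ the supremum is strictly less than $\mathcal E_u(\infty)$. *)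

(* Defs.v *)
From HB Require Import structures.
From mathcomp Require Import all_boot all_order all_algebra.
From mathcomp Require Import all_classical all_reals all_analysis.

Set Implicit Arguments.
Unset Strict Implicit.
Unset Printing Implicit Defensive.

Import Order.TTheory GRing.Theory Num.Theory.
Import numFieldNormedType.Exports.

Local Open Scope classical_set_scope.
Local Open Scope ring_scope.

Definition atomless d (Omega : measurableType d) (R : realType)
    (P : probability Omega R) : Prop :=
  forall A : set Omega, measurable A -> (0 < P A)%E ->
    exists B : set Omega,
      [/\ measurable B, B `<=` A, (0 < P B)%E & (P B < P A)%E].

(* Elements of [L] are functions, not classes modulo null sets. The suprema and
   infima are those of the partially ordered set [L] itself, for the a.s. order;
   they are unique up to a.s. equality. *)
Record riesz_space d (Omega : measurableType d) (R : realType)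
    (P : probability Omega R) (L : set {RV P >-> R}) : Prop := RieszSpace {
  riesz_zero : L (cst 0);
  riesz_linear : forall (c : R) (Y Z : {RV P >-> R}),
    L Y -> L Z -> L (c *: Y + Z);
  riesz_sup : forall Y Z : {RV P >-> R}, L Y -> L Z ->
    exists2 S : {RV P >-> R}, L S &
      [/\ {ae P, forall x, Y x <= S x}, {ae P, forall x, Z x <= S x} &
          forall W : {RV P >-> R}, L W -> {ae P, forall x, Y x <= W x} ->
            {ae P, forall x, Z x <= W x} -> {ae P, forall x, S x <= W x}];
  riesz_inf : forall Y Z : {RV P >-> R}, L Y -> L Z ->
    exists2 S : {RV P >-> R}, L S &
      [/\ {ae P, forall x, S x <= Y x}, {ae P, forall x, S x <= Z x} &
          forall W : {RV P >-> R}, L W -> {ae P, forall x, W x <= Y x} ->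
            {ae P, forall x, W x <= Z x} -> {ae P, forall x, W x <= S x}]
}.

(* Laws are compared on Borel sets only: [distribution P Y] is also defined,
   with no meaning, on the other subsets of [R]. *)
Definition law_invariant d (Omega : measurableType d) (R : realType)
    (P : probability Omega R) (L : set {RV P >-> R}) : Prop :=
  forall Y Z : {RV P >-> R}, L Y ->
    (forall A : set R, measurable A ->
       distribution P Z A = distribution P Y A) -> L Z.

Definition between_Linfty_L1 d (Omega : measurableType d) (R : realType)
    (P : probability Omega R) (L : set {RV P >-> R}) : Prop :=
  (forall Y : {RV P >-> R}, (Y : Omega -> R) \in Lfun P +oo%E -> L Y) /\
  (forall Y : {RV P >-> R}, L Y -> (Y : Omega -> R) \in Lfun P 1%E).

Definition dot (R : realType) n (x y : 'cV[R]_n) : R := (x^T *m y) 0 0.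

Definition quad (R : realType) n (A : 'M[R]_n) (x : 'cV[R]_n) : R :=
  (x^T *m A *m x) 0 0.

Definition symmetric_posdef (R : realType) n (A : 'M[R]_n) : Prop :=
  A^T = A /\ forall x : 'cV[R]_n, x != 0 -> 0 < quad A x.

(* The second parameter is the variance. The case [v = 0] is the point mass:
   the library's [normal_prob m 0] is the uniform law on [0, 1]. *)
Definition normal_law (R : realType) (m v : R) (A : set R) : \bar R :=
  if v == 0 then \d_m A else normal_prob m (Num.sqrt v) A.

(* [X ~ N_n(mu, Sigma)]: every linear combination [pi . X] has the univariate
   normal law [N(pi . mu, pi^T Sigma pi)]. *)
Definition multivariate_normal d (Omega : measurableType d) (R : realType)
    (P : probability Omega R) n (X : 'I_n -> {RV P >-> R})
    (mu : 'cV[R]_n) (Sigma : 'M[R]_n) : Prop :=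
  forall (pi : 'cV[R]_n) (A : set R), measurable A ->
    pushforward P (fun x => \sum_(i < n) pi i 0 * X i x) A =
    normal_law (dot pi mu) (quad Sigma pi) A.

Definition std_normal_cdf (R : realType) (x : R) : R :=
  fine (normal_prob 0 1 `]-oo, x]).

Definition std_normal_pdf (R : realType) : R -> R := normal_pdf 0 1.

(* Inverse function; the value outside the range ]0, 1[ of the cdf is junk. *)
Definition std_normal_cdf_inv (R : realType) (p : R) : R :=
  xget 0 [set x | std_normal_cdf x = p].

Definition SRmax (R : realType) n (mu : 'cV[R]_n) (Sigma : 'M[R]_n) : R :=
  sup [set dot pi mu / Num.sqrt (quad Sigma pi) | pi in [set pi | pi != 0]].

Definition power_utility (R : realType) (a b y : R) : R :=
  if 0 <= y then y `^ a else - ((- y) `^ b).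

Definition expected_utility d (Omega : measurableType d) (R : realType)
    (P : probability Omega R) (u : R -> R) (Y : Omega -> R) : \bar R :=
  ('E_P[u \o Y])%E.

Definition utility_at_infinity (R : realType) (u : R -> R) : \bar R :=
  lim ((u y)%:E @[y --> +oo%R]).

Definition VaR d (Omega : measurableType d) (R : realType)
    (P : probability Omega R) (alpha : R) (Y : Omega -> R) : R :=
  inf [set m : R | (P [set x | m + Y x < 0]%R <= alpha%:E)%E].

Definition ES d (Omega : measurableType d) (R : realType)
    (P : probability Omega R) (alpha : R) (Y : Omega -> R) : R :=
  alpha^-1 * \int[lebesgue_measure]_(beta in `]0, alpha[) VaR P beta Y.

Section portfolio_selection.
Context d (Omega : measurableType d) (R : realType) (P : probability Omega R).
Context (n : nat) (r : R) (S0 : 'I_n.+1 -> R) (S1 : 'I_n.+1 -> {RV P >-> R}).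

Definition initial_wealth (theta : 'cV[R]_n.+1) : R :=
  \sum_(i < n.+1) theta i 0 * S0 i.

Definition terminal_wealth (theta : 'cV[R]_n.+1) (x : Omega) : R :=
  \sum_(i < n.+1) theta i 0 * S1 i x.

Definition admissible (risk : (Omega -> R) -> R) (w Rmax : R) :
    set 'cV[R]_n.+1 :=
  [set theta | initial_wealth theta = w /\
               risk (terminal_wealth theta) <= Rmax].

Definition well_posed (u : R -> R) (risk : (Omega -> R) -> R) : Prop :=
  forall w Rmax : R, 0 < w -> risk (cst (w * (1 + r))) <= Rmax ->
    exists2 theta, admissible risk w Rmax theta &
      forall theta', admissible risk w Rmax theta' ->
        (expected_utility P u (terminal_wealth theta') <=
         expected_utility P u (terminal_wealth theta))%E.

Definition weakly_well_posed (u : R -> R) (risk : (Omega -> R) -> R) : Prop :=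
  forall w Rmax : R, 0 < w -> risk (cst (w * (1 + r))) <= Rmax ->
    (ereal_sup [set expected_utility P u (terminal_wealth theta)
               | theta in admissible risk w Rmax] < utility_at_infinity u)%E.

End portfolio_selection.

(* Main.v *)
Require Import Defs.
From HB Require Import structures.
From mathcomp Require Import all_boot all_order all_algebra.
From mathcomp Require Import all_classical all_reals all_analysis.
From mathcomp Require Import measurable_realfun.
From mathcomp Require Import ring lra.

(** Every portfolio has a normal terminal wealth [W + N(m, s^2)], and both risk
    measures have the form [- W - m + kappa * s] on it, with
    [kappa = - Phi^-1(alpha) > 0] for VaR and [kappa = phi(Phi^-1(alpha)) / alpha]
    for ES. The risk constraint is thus [kappa * s - m <= K] for a constant
    [K >= 0], while [m <= SR_max * s] with equality along the ray spanned by
    [Sigma^-1 mu]. Expected utility increases with [m] for fixed [s], so the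
    problem reduces to this ray. If [SR_max < kappa], then [s] ranges over a
    compact interval, on which expected utility is continuous by dominated
    convergence. If [SR_max >= kappa > 0], then the whole ray is admissible, and
    the expected utility of [W + t * N(SR_max, 1)] is at least
    [t^a * E[v(N(SR_max, 1))] - 1], where [v] is the odd power utility with
    exponent [a]; this tends to infinity since [E[v(N(0, 1))] = 0]. *)

Set Implicit Arguments.
Unset Strict Implicit.

Import Order.TTheory GRing.Theory Num.Theory.
Import numFieldNormedType.Exports.

Local Open Scope classical_set_scope.
Local Open Scope ring_scope.

(** * The standard normal distribution *)

Section std_normal.
Context {R : realType}.
Local Notation mu := (@lebesgue_measure R).
Local Notation Phi := (@std_normal_cdf R).
Local Notation phi := (@std_normal_pdf R).
Local Notation Phiinv := (@std_normal_cdf_inv R).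

Lemma std_normal_pdf_gt0 (x : R) : 0 < phi x.
Proof.
by rewrite /std_normal_pdf normal_pdfE ?oner_neq0// mulr_gt0 ?expR_gt0 ?normal_peak_gt0 ?oner_neq0.
Qed.

Lemma is_derive_std_normal_pdf (x : R) : is_derive x 1 phi (- x * phi x).
Proof.
have -> : phi = (fun y => normal_peak 1 * expR (- y ^+ 2 / 2)).
  apply/funext => y; rewrite /std_normal_pdf normal_pdfE ?oner_neq0//.
  by rewrite /normal_fun subr0 expr1n.
apply: is_derive_eq.
rewrite /GRing.scale /=.
field; by [].
Qed.

Lemma is_derive_std_normal_cdf (x : R) : is_derive x 1 Phi (phi x).
Proof.
(* The upper end [x + 1] makes [x] an interior point of the domain, as the fundamental theorem
   requires. *)
have h : mu.-integrable `]-oo, (x + 1)] (EFin \o phi).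
  apply: (@integrableS _ _ _ mu setT) => //.
  exact: integrable_normal_pdf.
have [|||d e] := @continuous_FTC1 R phi -oo%O x (x + 1) _ h.
- by rewrite ltrDl.
- by rewrite ltNyr.
- exact/continuous_normal_pdf/oner_neq0.
by apply: DeriveDef => //; rewrite -e derive1E.
Qed.

Lemma continuous_std_normal_cdf : continuous Phi.
Proof.
move=> x; apply/differentiable_continuous/derivable1_diffP.
by have [] := is_derive_std_normal_cdf x.
Qed.

Lemma std_normal_cdf_incr : {homo Phi : x y / x < y}.
Proof.
move=> x y xy.
apply: (@gtr0_derive1_incr R Phi x y) => //.
- by move=> z _; have [] := is_derive_std_normal_cdf z.
- move=> z _; rewrite derive1E; have [_ ->] := is_derive_std_normal_cdf z.
  exact: std_normal_pdf_gt0.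
- exact/continuous_subspaceT/continuous_std_normal_cdf.
Qed.

Lemma std_normal_cdf_mono : {mono Phi : x y / x <= y}.
Proof. exact/le_mono/std_normal_cdf_incr. Qed.

Lemma EFin_std_normal_cdf (x : R) : (Phi x)%:E = normal_prob (0:R) 1 `]-oo, x].
Proof. by rewrite /std_normal_cdf fineK// fin_num_measure. Qed.

(** The identity, as a random variable under [normal_prob 0 1], has [Phi] as its distribution
    function; the limits of [Phi] at both infinities follow from those of a general distribution
    function. *)
Let idR : measurableTypeR R -> R := idfun.
#[local] HB.instance Definition _ := isMeasurableFun.Build _ _ _ _ idR (@measurable_id _ _ setT).
Let idRV : {RV (@normal_prob R 0 1) >-> R} := idR.

Lemma std_normal_cdf_inv_ex (p : R) : 0 < p < 1 -> exists x, Phi x = p.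
Proof.
move=> /andP[p0 p1].
have [x hx] : exists x, Phi x < p.
  have h : Phi x @[x --> -oo] --> (0:R).
    apply/fine_cvg; rewrite /=.
    exact: (@cvg_cdfNy0 _ _ R _ idRV).
  have [M [_ hM]] := (cvgr_lt _ h _ p0).
  by exists (M - 1); apply: hM; rewrite gtrBl.
have [y hy] : exists x, p < Phi x.
  have h : Phi x @[x --> +oo] --> (1:R).
    apply/fine_cvg; rewrite /=.
    exact: (@cvg_cdfy1 _ _ R _ idRV).
  have [M [_ hM]] := (cvgr_gt _ h _ p1).
  by exists (M + 1); apply: hM; rewrite ltrDl.
have xy : x <= y by rewrite -std_normal_cdf_mono ltW// (lt_trans hx).
have [|z _ hz] := @IVT R Phi x y p xy (continuous_subspaceT continuous_std_normal_cdf).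
  by rewrite /Num.min /Num.max (lt_trans hx hy) (ltW hx) (ltW hy).
by exists z.
Qed.

Lemma std_normal_cdf_invK (p : R) : 0 < p < 1 -> Phi (Phiinv p) = p.
Proof.
move=> /std_normal_cdf_inv_ex[x hx].
by rewrite /std_normal_cdf_inv; case: xgetP => [y _ //|/(_ x)].
Qed.

Lemma std_normal_cdf_gt0 (x : R) : 0 < Phi x.
Proof.
apply: (@le_lt_trans _ _ (Phi (x - 1))); last by rewrite std_normal_cdf_incr// gtrBl.
by rewrite -lee_fin EFin_std_normal_cdf.
Qed.

Lemma std_normal_cdf_lt1 (x : R) : Phi x < 1.
Proof.
apply: (@lt_le_trans _ _ (Phi (x + 1))); first by rewrite std_normal_cdf_incr// ltrDl.
by rewrite -lee_fin EFin_std_normal_cdf probability_le1.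
Qed.

Lemma std_normal_cdfK (x : R) : Phiinv (Phi x) = x.
Proof.
apply: (inc_inj std_normal_cdf_mono).
by rewrite std_normal_cdf_invK// std_normal_cdf_gt0 std_normal_cdf_lt1.
Qed.

Lemma is_derive_std_normal_cdf_inv (p : R) : 0 < p < 1 ->
  is_derive p 1 Phiinv (phi (Phiinv p))^-1.
Proof.
move=> p01; rewrite -[in is_derive p](std_normal_cdf_invK p01).
apply: (@is_derive_inverse _ Phi).
- by near=> x; exact: std_normal_cdfK.
- by near=> x; exact: continuous_std_normal_cdf.
- exact: is_derive_std_normal_cdf.
- by rewrite gt_eqF// std_normal_pdf_gt0.
Unshelve. all: by end_near. Qed.

Lemma cvg_std_normal_pdfNy : phi x @[x --> -oo] --> (0:R).
Proof.
(* The square [(x + 1) ^+ 2] being nonnegative, [- x ^+ 2 / 2 <= 2^-1 + x]; hence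
   [phi x <= c * expR x]. *)
set c := normal_peak (1:R) * expR (2^-1).
apply: (@squeeze_cvgr _ _ _ _ (cst 0) (fun x => c * expR x)).
- near=> x; rewrite ltW ?std_normal_pdf_gt0//=.
  rewrite /std_normal_pdf normal_pdfE ?oner_neq0// /normal_fun subr0 expr1n.
  rewrite -mulrA -expRD ler_wpM2l ?normal_peak_ge0// ler_expR.
  rewrite -subr_ge0; have -> : 2^-1 + x - - x ^+ 2 / (1 *+ 2) = (x + 1) ^+ 2 / 2 :> R.
    by field.
  by rewrite divr_ge0// sqr_ge0.
- exact: cvg_cst.
- rewrite -[X in _ --> X](mulr0 c); apply: cvgMr.
  rewrite cvgNy_compNP; exact: cvgr_expR.
Unshelve. all: by end_near. Qed.

(* [- phi \o Phiinv] is an antiderivative of [Phiinv]. *)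
Lemma integral_std_normal_cdf_inv_cc (x y : R) : x < y ->
  (\int[mu]_(p in `[Phi x, Phi y]) (y - Phiinv p)%:E =
   (y * (Phi y - Phi x) + phi y - phi x)%:E)%E.
Proof.
move=> xy.
(* Since [phi' x = - x * phi x], the factor [(phi (Phiinv p))^-1] from the inverse function cancels
   and the second term has derivative [- Phiinv p]. *)
pose F (p : R) := y * p + phi (Phiinv p).
have dF (p : R) : 0 < p < 1 -> is_derive p 1 F (y - Phiinv p).
  move=> p01; rewrite /F.
  have d1 := is_derive_std_normal_cdf_inv p01.
  have d2 := is_derive_std_normal_pdf (Phiinv p).
  have d3 := @is_derive1_comp _ phi Phiinv p _ _ d2 d1.
  apply: is_derive_eq.
  have pn0 : phi (Phiinv p) != 0 by rewrite gt_eqF ?std_normal_pdf_gt0.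
  rewrite /GRing.scale /=. by field.
have in01 p : p \in `[Phi x, Phi y] -> 0 < p < 1.
  rewrite in_itv/= => /andP[xp py].
  by rewrite (lt_le_trans (std_normal_cdf_gt0 x) xp) (le_lt_trans py (std_normal_cdf_lt1 y)).
have Pxy := std_normal_cdf_incr xy.
have cF p : 0 < p < 1 -> {for p, continuous F}.
  move=> /dF[h _]; exact/differentiable_continuous/derivable1_diffP.
rewrite (@continuous_FTC2 _ _ F)//.
- rewrite -EFinB /F !std_normal_cdfK; congr EFin; ring.
- apply: continuous_in_subspaceT => p /set_mem /in01 p01.
  apply: cvgB; first exact: cvg_cst.
  have [h _] := is_derive_std_normal_cdf_inv p01.
  exact/differentiable_continuous/derivable1_diffP.
- split.
  + move=> p pp; have [|//] := dF p; apply: in01; exact: subset_itv_oo_cc pp.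
  + apply: cvg_at_right_filter; apply: cF; apply: in01.
    by rewrite in_itv/= lexx ltW.
  + apply: cvg_at_left_filter; apply: cF; apply: in01.
    by rewrite in_itv/= lexx ltW.
- move=> p pp; rewrite derive1E; have [|_ ->//] := dF p.
  apply: in01; exact: subset_itv_oo_cc pp.
Qed.

Lemma measurable_std_normal_cdf_inv (a : R) : a <= 1 ->
  measurable_fun `]0, a[ Phiinv.
Proof.
move=> a1; apply: open_continuous_measurable_fun; first exact: interval_open.
move=> p /set_mem/=; rewrite in_itv/= => /andP[p0 pa].
have [|h _] := is_derive_std_normal_cdf_inv (p := p); first by rewrite p0 (lt_le_trans pa).
exact/differentiable_continuous/derivable1_diffP.
Qed.

Lemma cvg_std_normal_cdfNy : Phi x @[x --> -oo] --> (0:R).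
Proof. exact/fine_cvg/(@cvg_cdfNy0 _ _ R _ idRV). Qed.

(** [Phiinv] is unbounded near 0, so the integral is a limit over the sets [E n], which stay away
    from 0 and exhaust []0, a[]. Subtracting from [Phiinv a] makes the integrand nonnegative, as
    monotone convergence demands. *)
Lemma integral_std_normal_cdf_inv (a : R) : 0 < a < 1 ->
  (\int[mu]_(p in `]0%R, a[) (Phiinv a - Phiinv p)%:E =
   (Phiinv a * a + phi (Phiinv a))%:E)%E.
Proof.
move=> a01; have [a0 a1] := andP a01; set y := Phiinv a.
have ya : Phi y = a by exact: std_normal_cdf_invK.
pose E n := `[Phi (y - n.+1%:R), a[%classic.
have EU : `]0, a[%classic = \bigcup_n E n.
  apply/seteqP; split => p /=.
    rewrite in_itv/= => /andP[p0 pa].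
    have p01 : 0 < p < 1 by rewrite p0 (lt_trans pa).
    exists (Num.truncn (y - Phiinv p)) => //=; rewrite /E/= in_itv/= pa andbT.
    rewrite -[leRHS](std_normal_cdf_invK p01) std_normal_cdf_mono lerBlDl -lerBlDr.
    exact/ltW/truncnS_gt.
  move=> [n _]; rewrite /E /= !in_itv/= => /andP[h ->]; rewrite andbT.
  exact: lt_le_trans (std_normal_cdf_gt0 _) h.
have mE n : measurable_fun (E n) (EFin \o (fun p : R => y - Phiinv p)).
  apply: (@measurable_funS _ _ _ _ `]0, a[) => //.
    by rewrite EU; apply: bigcup_sup.
  apply/measurable_EFinP/measurable_funB => //.
  by apply: measurable_std_normal_cdf_inv; exact: ltW.
have h : (\int[mu]_(p in E n) (y - Phiinv p)%:E @[n --> \oo] -->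
    \int[mu]_(p in \bigcup_n E n) (y - Phiinv p)%:E)%E.
  apply: ge0_nondecreasing_set_cvg_integral => //.
  - move=> m n mn; rewrite subsetEset; apply: subset_itvr.
    by rewrite bnd_simp std_normal_cdf_mono lerD2l lerN2 ler_nat ltnS.
  - by move=> n; rewrite /E.
  - move=> n p; rewrite /E/= in_itv/= => /andP[p0 pa].
    have p01 : 0 < p < 1.
      by rewrite (lt_le_trans _ p0) ?std_normal_cdf_gt0// (lt_trans pa).
    rewrite lee_fin subr_ge0 -std_normal_cdf_mono ya std_normal_cdf_invK//.
    exact: ltW.
rewrite EU; apply: cvg_unique h _ => //.
have -> : (fun n => \int[mu]_(p in E n) (y - Phiinv p)%:E)%E =
   EFin \o (fun n => y * (a - Phi (y - n.+1%:R)) + phi y - phi (y - n.+1%:R)).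
  apply/funext => n /=.
  rewrite /E integral_itv_bndo_bndc; last exact: mE.
  by rewrite -ya integral_std_normal_cdf_inv_cc// gtrBl.
apply/fine_cvgP; split; first by near=> n.
have yNy : y - n.+1%:R @[n --> \oo] --> -oo.
  apply/cvgrNyPle => A; near=> n; rewrite lerBlDl -lerBlDr.
  by rewrite (@le_trans _ _ n%:R) ?ler_nat//; near: n; exact: nbhs_infty_ger.
have -> : y * a + phi y = y * (a - 0) + phi y - 0 by rewrite !subr0.
apply: cvgB; last exact: (cvg_comp _ _ yNy cvg_std_normal_pdfNy).
apply: cvgD; last exact: cvg_cst.
apply: cvgMr; apply: cvgB; first exact: cvg_cst.
exact: (cvg_comp _ _ yNy cvg_std_normal_cdfNy).
Unshelve. all: by end_near. Qed.

Lemma std_normal_cdf_inv_le (p x : R) : 0 < p < 1 -> (Phiinv p <= x) = (p <= Phi x).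
Proof. by move=> p01; rewrite -std_normal_cdf_mono std_normal_cdf_invK. Qed.

End std_normal.

(** * Translation of normal laws *)

Lemma pushforward_lebesgue_shift (R : realType) (c : R) (A : set R) : measurable A ->
  pushforward (@lebesgue_measure R) (fun x : measurableTypeR R => (x + c : measurableTypeR R)) A =
  lebesgue_measure A.
Proof.
move=> mA; apply/esym; apply: lebesgue_measure_unique => //=.
  by apply: continuous_measurable_fun => x; apply: cvgD; [exact: cvg_id|exact: cvg_cst].
move=> ms _ [[a b]] _ <-.
rewrite /pushforward.
rewrite (_ : _ @^-1` _ = `]a - c, b - c]%classic); last first.
  by apply/seteqP; split => x/=; rewrite !in_itv/= ltrBlDr lerBrDr.
rewrite !lebesgue_measure_itv/= !lte_fin ltrD2r; case: ifP => // _.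
by rewrite -!EFinB; congr EFin; ring.
Qed.

Lemma normal_pdf_shift (R : realType) (m s c x : R) : s != 0 ->
  normal_pdf (m + c) s (x + c) = normal_pdf m s x.
Proof.
move=> s0; rewrite !normal_pdfE// /normal_fun.
by have -> : x + c - (m + c) = x - m by ring.
Qed.

(** Change of variables: Lebesgue measure is translation invariant and the density moves along with
    its mean. *)
Lemma normal_prob_shift (R : realType) (m s c : R) (A : set R) : s != 0 -> measurable A ->
  normal_prob m s ((fun x => x + c) @^-1` A) = normal_prob (m + c) s A.
Proof.
move=> s0 mA; rewrite /normal_prob.
pose f (x : measurableTypeR R) : \bar R := (normal_pdf (m + c) s x)%:E.
pose g (x : measurableTypeR R) : measurableTypeR R := x + c.
have mg : measurable_fun [set: measurableTypeR R] g.
  by apply: continuous_measurable_fun => x; apply: cvgD; [exact: cvg_id|exact: cvg_cst].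
have mf : measurable_fun A f.
  by apply: measurable_funTS; apply/measurable_EFinP; exact: measurable_normal_pdf.
have f0 : {in A, forall y, (0 <= f y)%E}.
  by move=> x _; rewrite /f lee_fin normal_pdf_ge0.
have := ge0_integral_pushforward mg lebesgue_measure mA mf f0.
have -> : f \o g = (fun x : measurableTypeR R => (normal_pdf m s x)%:E).
  by apply/funext => x; rewrite /f /g /= normal_pdf_shift.
move=> h; refine (eq_trans (esym h) _).
apply: eq_measure_integral => B mB BA; exact: pushforward_lebesgue_shift.
Qed.

(** * Power utility *)

Section power_utility.
Context {R : realType}.
Implicit Types a b t x y : R.

(** A form without case distinction, whose two terms are separately continuous and monotone; nonzero
    exponents make the inactive term vanish. *)
Lemma power_utilityE a b y : a != 0 -> b != 0 ->
  power_utility a b y = Num.max 0 y `^ a - Num.max 0 (- y) `^ b.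
Proof.
move=> a0 b0; rewrite /power_utility; case: (leP 0 y) => y0.
  by rewrite max_l ?oppr_le0// powR0// subr0.
by rewrite max_r ?oppr_ge0 ?ltW// powR0// sub0r.
Qed.

Lemma continuous_max0_powR a : 0 < a -> continuous (fun y : R => Num.max 0 y `^ a).
Proof.
move=> a0 y; have [y0|y0|->] := ltgtP y 0.
- rewrite /continuous_at max_l ?ltW//.
  have h : cst (0 `^ a) z @[z --> y] --> (0 `^ a : R) by exact: cvg_cst.
  apply: cvg_trans h; apply: near_eq_cvg; near=> z.
  by rewrite max_l//; apply: ltW; near: z; exact: lt_nbhsl.
- rewrite /continuous_at max_r ?ltW//.
  have h : {for y, continuous (fun z : R => z `^ a)}.
    apply/differentiable_continuous/derivable1_diffP/derivable_powR.
    by rewrite in_itv/= y0.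
  apply: cvg_trans h; apply: near_eq_cvg; near=> z.
  by rewrite max_r//; apply: ltW; near: z; exact: lt_nbhsr.
- rewrite /continuous_at maxxx powR0 ?gt_eqF//.
  apply/cvgrPdist_lt => e e0.
  near=> z; rewrite sub0r normrN ger0_norm ?powR_ge0//.
  rewrite (@le_lt_trans _ _ (`|z| `^ a))//.
    apply: ge0_ler_powR; rewrite ?nnegrE ?(ltW a0)//.
      by rewrite le_max lexx.
    by rewrite ge_max normr_ge0 ler_norm.
  rewrite -[ltRHS](powRr1 (ltW e0)) -(mulVf (lt0r_neq0 a0)) powRrM.
  rewrite gt0_ltr_powR ?nnegrE ?powR_ge0//.
  by near: z; apply: (@nbhs0_lt _ R^o); rewrite powR_gt0.
Unshelve. all: by end_near. Qed.

Lemma continuous_power_utility a b : 0 < a -> 0 < b ->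
  continuous (power_utility a b).
Proof.
move=> a0 b0; rewrite (_ : power_utility a b =
    fun y => Num.max 0 y `^ a - Num.max 0 (- y) `^ b); last first.
  by apply/funext => y; rewrite power_utilityE// gt_eqF.
move=> y; apply: cvgB; first exact: continuous_max0_powR.
apply: (cvg_comp (fun z : R => - z) (fun z => Num.max 0 z `^ b)).
  by apply: cvgN; exact: cvg_id.
exact: continuous_max0_powR.
Qed.

Lemma power_utility_homo a b : 0 < a -> 0 < b ->
  {homo power_utility a b : x y / x <= y}.
Proof.
move=> a0 b0 x y xy; rewrite !power_utilityE ?gt_eqF//.
have mono (c v w : R) : 0 < c -> v <= w -> Num.max 0 v `^ c <= Num.max 0 w `^ c.
  have max0 (z : R) : Num.max 0 z \is Num.nneg by rewrite nnegrE le_max lexx.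
  move=> c0 vw; apply: ge0_ler_powR (max0 v) (max0 w) _; first exact: ltW.
  by rewrite ge_max !le_max lexx vw orbT.
by rewrite lerB// mono// lerN2.
Qed.

Lemma powR_le_add1 a y : 0 < a -> a <= 1 -> 0 <= y -> y `^ a <= 1 + y.
Proof.
move=> a0 a1 y0; have [y1|y1] := leP 1 y.
  by rewrite (le_trans (ler1_powR _ _))// lerDr.
rewrite (@le_trans _ _ 1)// ?lerDl//.
by rewrite -[leRHS](congr1 (@^~ a) (@powR1 R)) ge0_ler_powR ?nnegrE// ?ltW.
Qed.

(** Linear growth makes the utility of an integrable wealth integrable and later supplies the
    dominating function. *)
Lemma norm_power_utility_le a b y : 0 < a -> a <= 1 -> 0 < b -> b <= 1 ->
  `|power_utility a b y| <= 1 + `|y|.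
Proof.
move=> a0 a1 b0 b1; rewrite /power_utility; case: (leP 0 y) => y0.
  by rewrite ger0_norm ?powR_ge0// ger0_norm// powR_le_add1.
by rewrite normrN ger0_norm ?powR_ge0// ltr0_norm// powR_le_add1// oppr_ge0 ltW.
Qed.

Lemma power_utilityN a y : 0 < a -> power_utility a a (- y) = - power_utility a a y.
Proof. by move=> a0; rewrite !power_utilityE ?gt_eqF// opprK opprB. Qed.

Lemma power_utilityZ a t y : 0 < a -> 0 <= t ->
  power_utility a a (t * y) = t `^ a * power_utility a a y.
Proof.
move=> a0; rewrite le_eqVlt => /predU1P[<-|t0].
  by rewrite mul0r powR0 ?gt_eqF// mul0r /power_utility lexx powR0 ?gt_eqF.
rewrite /power_utility pmulr_rge0//; case: (leP 0 y) => y0.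
  by rewrite powRM// ltW.
by rewrite -mulrN powRM ?mulrN// ?ltW// oppr_gt0.
Qed.

(* [|y|^b <= 1 + |y|^a] since [b <= a]. *)
Lemma power_utility_ge a b y : 0 < b -> b <= a ->
  power_utility a a y - 1 <= power_utility a b y.
Proof.
move=> b0 ba; rewrite /power_utility; case: (leP 0 y) => y0; first by rewrite gerBl.
rewrite -opprD lerN2 ; have [y1|y1] := leP 1 (- y).
  by rewrite (le_trans (ler_powR y1 ba))// lerDl.
rewrite (@le_trans _ _ 1)// ?lerDr ?powR_ge0//.
by rewrite -[leRHS](congr1 (@^~ b) (@powR1 R)) ge0_ler_powR ?nnegrE ?ltW// oppr_gt0.
Qed.

Lemma utility_at_infinity_power a b : 0 < a ->
  utility_at_infinity (power_utility a b) = +oo%E.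
Proof.
move=> a0; apply: cvg_lim => //; apply/cvgeyPge => A.
near=> y; rewrite lee_fin.
have y0 : 0 <= y by near: y; exact: nbhs_pinfty_ge.
rewrite /power_utility y0.
have -> : A <= y `^ a.
  apply: (@le_trans _ _ (Num.max 0 A)); first by rewrite le_max lexx orbT.
  have M0 : 0 <= Num.max 0 A by rewrite le_max lexx.
  rewrite -[leLHS](powRr1 M0) -(mulVf (lt0r_neq0 a0)) powRrM.
  apply: ge0_ler_powR; [exact: ltW|by rewrite nnegrE powR_ge0|by rewrite nnegrE|].
  by near: y; apply: nbhs_pinfty_ge; exact: num_real.
by [].
Unshelve. all: by end_near. Qed.

End power_utility.

(** * The maximal Sharpe ratio *)

Section max_sharpe_ratio.
Context {R : realType} {n : nat}.
Implicit Types (A : 'M[R]_n) (x y m : 'cV[R]_n) (c : R).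

Lemma dotZ c x y : dot (c *: x) y = c * dot x y.
Proof. by rewrite /dot linearZ/= -scalemxAl mxE. Qed.

Lemma quadZ A c x : quad A (c *: x) = c ^+ 2 * quad A x.
Proof. by rewrite /quad -scalemxAr [_^T]linearZ/= -!scalemxAl !mxE mulrA. Qed.

Lemma quad0 A : quad A 0 = 0.
Proof. by rewrite /quad mulmx0 mxE. Qed.

Lemma quad_gt0 A x : symmetric_posdef A -> x != 0 -> 0 < quad A x.
Proof. by move=> [_]; exact. Qed.

Lemma quad_ge0 A x : symmetric_posdef A -> 0 <= quad A x.
Proof.
move=> [_ hA]; have [->|x0] := eqVneq x 0; first by rewrite quad0.
exact/ltW/hA.
Qed.

Lemma sqrt_quadZ A c x : 0 <= c -> Num.sqrt (quad A (c *: x)) = c * Num.sqrt (quad A x).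
Proof. by move=> c0; rewrite quadZ sqrtrM ?sqr_ge0// sqrtr_sqr ger0_norm. Qed.

(** A nonzero vector [v] with [v *m A = 0] would satisfy [quad A v^T = 0]. *)
Lemma symmetric_posdef_unitmx A : symmetric_posdef A -> A \in unitmx.
Proof.
move=> [_ hA]; rewrite -row_free_unit -kermx_eq0; apply/negPn/negP.
move=> /rowV0Pn[v /sub_kermxP vA v0].
have : 0 < quad A v^T by apply: hA; rewrite trmx_eq0.
by rewrite /quad trmxK vA mul0mx mxE ltxx.
Qed.

Lemma dot_quad_invmx A x m : symmetric_posdef A ->
  dot x m = (x^T *m A *m (invmx A *m m)) 0 0.
Proof. by move=> /symmetric_posdef_unitmx hA; rewrite mulmxA mulmxK. Qed.

Lemma quad_invmx A m : symmetric_posdef A ->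
  quad (invmx A) m = quad A (invmx A *m m).
Proof.
move=> hA; have uA := symmetric_posdef_unitmx hA; have [sA _] := hA.
by rewrite /quad trmx_mul trmx_inv sA -!mulmxA mulKVmx.
Qed.

(** With [b] the mixed term, the form at [quad A x *: y - b *: x] is nonnegative and equals [quad A
    x * (quad A x * quad A y - b ^+ 2)]; the first factor is positive for nonzero [x]. *)
Lemma posdef_cauchy_schwarz A x y : symmetric_posdef A ->
  ((x^T *m A *m y) 0 0) ^+ 2 <= quad A x * quad A y.
Proof.
move=> hA; have [sA _] := hA.
have [->|x0] := eqVneq x 0.
  by rewrite trmx0 !mul0mx mxE expr0n/= quad0 mul0r.
have qx := quad_gt0 hA x0.
set b : R := (x^T *m A *m y) 0 0.
have bC : (y^T *m A *m x) 0 0 = b.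
  have e : (y^T *m A *m x)^T = x^T *m A *m y by rewrite !trmx_mul trmxK sA mulmxA.
  by rewrite /b -e [RHS]mxE.
have := quad_ge0 (quad A x *: y - b *: x) hA.
have -> : quad A (quad A x *: y - b *: x) = ((quad A x *: y^T - b *: x^T) *m A *m
    (quad A x *: y - b *: x)) 0 0.
  by rewrite /quad; congr ((_ *m _ *m _) 0 0); apply/matrixP => i j; rewrite !mxE.
rewrite !mulmxBl !mulmxBr.
rewrite -!scalemxAr -!scalemxAl.
have E (u v : 'M[R]_1) : (u - v) 0 0 = u 0 0 - v 0 0 by rewrite !mxE.
have Z (k : R) (v : 'M[R]_1) : (k *: v) 0 0 = k * v 0 0 by rewrite mxE.
rewrite !E !Z bC -/b -/(quad A x) -/(quad A y) => h.
rewrite -subr_ge0 -(pmulr_rge0 _ qx).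
by apply: le_trans h _; rewrite le_eqVlt; apply/orP; left; apply/eqP; ring.
Qed.

(** Cauchy-Schwarz for the inner product of [A], applied to [x] and [invmx A *m m], whose inner
    product is [dot x m]. *)
Lemma sharpe_ratio_le A x m : symmetric_posdef A ->
  dot x m <= Num.sqrt (quad (invmx A) m) * Num.sqrt (quad A x).
Proof.
move=> hA; rewrite (dot_quad_invmx _ _ hA) quad_invmx//.
rewrite (le_trans (ler_norm _))// -sqrtr_sqr -sqrtrM ?quad_ge0// ler_sqrt.
  by rewrite mulrC posdef_cauchy_schwarz.
by rewrite mulr_ge0 ?quad_ge0.
Qed.

Lemma max_sharpe_portfolio A m : (0 < n)%N -> symmetric_posdef A ->
  exists2 x, quad A x = 1 & dot x m = Num.sqrt (quad (invmx A) m).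
Proof.
move=> n0 hA; have uA := symmetric_posdef_unitmx hA.
have [y y0 hy] : exists2 y : 'cV[R]_n, y != 0 &
    dot y m = Num.sqrt (quad (invmx A) m) * Num.sqrt (quad A y).
  (* Equality in Cauchy-Schwarz holds in the direction [invmx A *m m]. It vanishes for [m = 0],
     where any nonzero vector serves; the constant one is nonzero because [n > 0]. *)
  have [->|m0] := eqVneq m 0.
    exists (const_mx 1); last by rewrite /dot mulmx0 mxE quad0 sqrtr0 mul0r.
    by apply/eqP => /matrixP/(_ (Ordinal n0) 0)/eqP; rewrite !mxE oner_eq0.
  exists (invmx A *m m).
    by apply: contra_neq m0 => e; rewrite -[m](mulKVmx uA) e mulmx0.
  rewrite quad_invmx// -expr2 sqr_sqrtr ?quad_ge0//.
  by rewrite (dot_quad_invmx _ _ hA).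
have q0 := quad_gt0 hA y0.
have s0 : Num.sqrt (quad A y) != 0 by rewrite gt_eqF// sqrtr_gt0.
exists ((Num.sqrt (quad A y))^-1 *: y).
  by rewrite quadZ exprVn sqr_sqrtr ?ltW// mulVf// gt_eqF.
by rewrite dotZ hy mulrC mulfK.
Qed.

Lemma SRmaxE A m : (0 < n)%N -> symmetric_posdef A ->
  SRmax m A = Num.sqrt (quad (invmx A) m).
Proof.
move=> n0 hA; rewrite /SRmax; set S := (X in sup X); set s := RHS.
have ubS : ubound S s.
  move=> _ [x x0 <-]; rewrite ler_pdivrMr ?sharpe_ratio_le//.
  by rewrite sqrtr_gt0 quad_gt0.
have [x qx dx] := max_sharpe_portfolio m n0 hA.
have Ss : S s.
  exists x; last by rewrite qx sqrtr1 divr1.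
  by apply/eqP => x0; move/eqP: qx; rewrite x0 quad0 eq_sym oner_eq0.
apply/eqP; rewrite eq_le; apply/andP; split.
  by apply: ge_sup => //; exists s.
by apply: ub_le_sup => //; exists s.
Qed.

End max_sharpe_ratio.

(** * Value at Risk and Expected Shortfall of normal variables *)

Section standard_normal_variable.
Context d (Omega : measurableType d) (R : realType) (P : probability Omega R).
Local Notation Phi := (@std_normal_cdf R).
Local Notation phi := (@std_normal_pdf R).
Local Notation Phiinv := (@std_normal_cdf_inv R).

Definition std_normal_law (Z : Omega -> R) : Prop :=
  forall A : set R, measurable A -> P (Z @^-1` A) = normal_prob 0 1 A.

(** Both sides are the integral of [f] against the standard normal law. *)
Lemma integral_std_normal_law (Z1 Z2 : Omega -> R) (f : R -> R) :
  measurable_fun setT Z1 -> measurable_fun setT Z2 -> measurable_fun setT f ->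
  std_normal_law Z1 -> std_normal_law Z2 ->
  P.-integrable setT (EFin \o (f \o Z1)) -> P.-integrable setT (EFin \o (f \o Z2)) ->
  (\int[P]_x (f (Z1 x))%:E = \int[P]_x (f (Z2 x))%:E)%E.
Proof.
move=> mZ1 mZ2 mf N1 N2 i1 i2.
have h (Z : Omega -> R) : measurable_fun setT Z -> std_normal_law Z ->
    P.-integrable setT (EFin \o (f \o Z)) ->
    (\int[P]_x (f (Z x))%:E = \int[normal_prob (0:R) 1]_y (f y)%:E)%E.
  move=> mZ NZ iZ.
  have mZ' : measurable_fun setT (Z : Omega -> measurableTypeR R) by [].
  transitivity (\int[pushforward P (Z : Omega -> measurableTypeR R)]_y (f y)%:E)%E.
    rewrite integral_pushforward//.
    exact/measurable_EFinP.
  by apply: eq_measure_integral => A mA _; exact: NZ.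
by rewrite !h.
Qed.

(** VaR is defined with a strict inequality and [Phi] with a weak one; a law with a density gives no
    mass to the endpoint. *)
Lemma std_normal_law_lt (Z : Omega -> R) (t : R) : std_normal_law Z ->
  P [set x | Z x < t] = (Phi t)%:E.
Proof.
move=> NZ; have := NZ `]-oo, t[%classic (measurable_itv _).
rewrite (_ : Z @^-1` _ = [set x | Z x < t]); last first.
  by apply/seteqP; split => x /=; rewrite in_itv.
move=> ->; rewrite EFin_std_normal_cdf /normal_prob.
rewrite integral_itv_bndo_bndc//.
apply: measurable_funTS; apply/measurable_EFinP; exact: measurable_normal_pdf.
Qed.

(** The events [- Z x < 0] and [Z x <= 0] are complementary, and by symmetry both have probability
    [Phi 0]. *)
Lemma std_normal_cdf0 (Z : Omega -> R) : measurable_fun setT Z ->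
  std_normal_law Z -> std_normal_law (fun x => - Z x) -> Phi 0 = 2^-1.
Proof.
move=> mZ NZ NZN.
have mZ0 : measurable [set x | - Z x < 0].
  rewrite (_ : [set x | _] = Z @^-1` `]0, +oo[%classic); last first.
    by apply/seteqP; split => x /=; rewrite in_itv/= andbT oppr_lt0.
  by rewrite -[X in measurable X]setTI; exact: mZ.
have := probability_setC P mZ0.
rewrite (std_normal_law_lt _ NZN) (_ : ~` _ = Z @^-1` `]-oo, 0]); last first.
  by apply/seteqP; split => x /=; rewrite in_itv/= oppr_lt0 leNgt => /negP.
rewrite NZ// -EFin_std_normal_cdf -EFinB => -[h]; lra.
Qed.

Lemma inf_ge_set (x : R) : inf [set y | x <= y] = x.
Proof.
apply/eqP; rewrite eq_le; apply/andP; split.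
  by apply: ge_inf => /=; [exists x|exact: lexx].
by apply: lb_le_inf => //; exists x => /=.
Qed.

Lemma VaR_cst (c b : R) : 0 < b < 1 -> VaR P b (cst c) = - c.
Proof.
move=> /andP[b0 b1]; rewrite /VaR -[RHS]inf_ge_set; congr inf.
apply/seteqP; split => m /=.
  rewrite lerNl => h; rewrite leNgt; apply/negP => mc; move: h.
  rewrite (_ : [set _ | _] = setT) ?probability_setT ?lee_fin; last first.
    by apply/seteqP; split => // x _ /=; rewrite -ltrBrDr sub0r ltrNr.
  by rewrite leNgt b1.
move=> cm; rewrite (_ : [set _ | _] = set0) ?measure0 ?lee_fin ?ltW//.
by apply/seteqP; split => // x /=; rewrite ltNge -lerBlDr sub0r cm.
Qed.

(** After standardization, [c] is acceptable exactly when [(- c - m) / s <= Phiinv b], so the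
    acceptable amounts form a closed half-line whose left end is the value. *)
Lemma VaR_normal (Y : Omega -> R) (m s b : R) : 0 < s -> 0 < b < 1 ->
  std_normal_law (fun x => (Y x - m) / s) -> VaR P b Y = - m - s * Phiinv b.
Proof.
move=> s0 b01 NY; rewrite /VaR -[RHS]inf_ge_set; congr inf.
apply: eq_set => c; apply/propext.
rewrite (_ : [set x | c + Y x < 0] = [set x | (Y x - m) / s < (- c - m) / s]); last first.
  by apply/seteqP; split => x /=; rewrite ltr_pM2r ?invr_gt0// => h; lra.
rewrite (std_normal_law_lt (Z := fun x => (Y x - m) / s))// lee_fin.
rewrite -[b in _ <= b](std_normal_cdf_invK b01) std_normal_cdf_mono ler_pdivrMr//.
by split => h; lra.
Qed.

Lemma ES_cst (c a : R) : 0 < a < 1 -> ES P a (cst c) = - c.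
Proof.
move=> /andP[a0 a1]; rewrite /ES.
rewrite (@eq_Rintegral _ _ _ _ _ (cst (- c))); last first.
  move=> p; rewrite inE/= in_itv/= => /andP[p0 pa].
  by rewrite VaR_cst// p0 (lt_trans pa).
rewrite Rintegral_cst//= lebesgue_measure_itv/= lte_fin a0 sube0/=.
by rewrite mulrC mulfK// gt_eqF.
Qed.

Lemma ES_normal (Y : Omega -> R) (m s a : R) : 0 < s -> 0 < a < 1 ->
  std_normal_law (fun x => (Y x - m) / s) ->
  ES P a Y = - m + s * (phi (Phiinv a) / a).
Proof.
move=> s0 a01 NY; have /andP[a0 a1] := a01; rewrite /ES; set q := Phiinv a.
(* The VaR at level [p] is split into its value at level [a] and the nonnegative remainder
   [s * (q - Phiinv p)], whose integral is known; the two terms in [q] then cancel. *)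
transitivity (a^-1 * \int[lebesgue_measure]_(p in `]0%R, a[) ((- m - s * q) + s * (q - Phiinv p))).
  congr (_ * _); apply: eq_Rintegral => p; rewrite inE/= in_itv/= => /andP[p0 pa].
  rewrite (VaR_normal (Y := Y) (m := m) (s := s))//; first by ring.
  by rewrite p0 (lt_trans pa).
have mh : measurable_fun `]0, a[ (fun p : R => q - Phiinv p).
  by apply: measurable_funB => //; apply: measurable_std_normal_cdf_inv; exact: ltW.
have h0 (p : R) : `]0, a[%classic p -> 0 <= q - Phiinv p.
  rewrite /= in_itv/= => /andP[p0 pa].
  have p01 : 0 < p < 1 by rewrite p0 (lt_trans pa).
  by rewrite subr_ge0 std_normal_cdf_inv_le// std_normal_cdf_invK// ltW.
have ih : (@lebesgue_measure R).-integrable `]0, a[ (EFin \o (fun p : R => q - Phiinv p)).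
  apply/integrableP; split; first exact/measurable_EFinP.
  have -> : (\int[lebesgue_measure]_(p in `]0%R, a[) `|(EFin \o (fun p : R => q - Phiinv p)%R) p| =
      \int[lebesgue_measure]_(p in `]0%R, a[) (q - Phiinv p)%:E)%E.
    by apply: eq_integral => p /set_mem /h0 pp; rewrite /= ger0_norm.
  by rewrite integral_std_normal_cdf_inv// ltry.
rewrite RintegralD//=; last 2 first.
- apply/integrableP; split; first exact/measurable_EFinP.
  rewrite (_ : (fun x => _) = cst `|(- m - s * q)%:E|%E)// integral_cst//=.
  by rewrite lebesgue_measure_itv/= lte_fin a0 sube0 ltry.
- by apply: (integrableZl _ s ih).
rewrite RintegralZl// Rintegral_cst//= lebesgue_measure_itv/= lte_fin a0 sube0/=.
rewrite {1}/Rintegral integral_std_normal_cdf_inv//=.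
by rewrite -/q; field; rewrite gt_eqF.
Qed.

End standard_normal_variable.

(** * Expected utility of portfolios *)

Section portfolios.
Context d (Omega : measurableType d) (R : realType) (P : probability Omega R).
Context (n : nat) (X : 'I_n -> {RV P >-> R}) (mu : 'cV[R]_n) (Sigma : 'M[R]_n).

Definition excess_gain (pi : 'cV[R]_n) (x : Omega) : R :=
  \sum_(i < n) pi i 0 * X i x.

Lemma excess_gainZ (c : R) pi x : excess_gain (c *: pi) x = c * excess_gain pi x.
Proof.
by rewrite /excess_gain mulr_sumr; apply: eq_bigr => i _; rewrite mxE mulrA.
Qed.

Lemma excess_gain0 x : excess_gain 0 x = 0.
Proof. by rewrite /excess_gain big1// => i _; rewrite mxE mul0r. Qed.

Lemma measurable_excess_gain pi : measurable_fun setT (excess_gain pi).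
Proof. by apply: measurable_sum => i; apply: measurable_funM. Qed.

Lemma integrable_excess_gain pi :
  (forall i, P.-integrable setT (EFin \o X i)) ->
  P.-integrable setT (EFin \o excess_gain pi).
Proof.
move=> iX; rewrite (_ : EFin \o _ = fun x => (\sum_(i < n) (pi i 0 * X i x)%:E)%E); last first.
  by apply/funext => x; rewrite /= sumEFin.
apply: integrable_sum => // i _.
exact: (integrableZl _ (pi i 0) (iX i)).
Qed.

Hypothesis hS : symmetric_posdef Sigma.
Hypothesis hX : multivariate_normal X mu Sigma.

Lemma std_normal_law_excess_gain (pi : 'cV[R]_n) : pi != 0 ->
  std_normal_law P (fun x => (excess_gain pi x - dot pi mu) / Num.sqrt (quad Sigma pi)).
Proof.
move=> pi0 A mA; set s := Num.sqrt _.
have q0 : 0 < quad Sigma pi by exact: quad_gt0.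
have s0 : 0 < s by rewrite sqrtr_gt0.
pose c := - dot pi mu / s.
have mB : measurable ((fun y => y + c) @^-1` A).
  have mc : measurable_fun [set: R] (fun y : R => y + c).
    by apply: continuous_measurable_fun => x; apply: cvgD; [exact: cvg_id|exact: cvg_cst].
  by rewrite -[X in measurable X]setTI; exact: mc.
(* Rescaling the portfolio itself gives unit variance, so the normal law has only to be translated,
   by [c], to mean 0. *)
have := hX (s^-1 *: pi) mB.
have q1 : quad Sigma (s^-1 *: pi) = 1.
  by rewrite quadZ exprVn sqr_sqrtr ?(ltW q0)// mulVf// gt_eqF.
rewrite /normal_law q1 oner_eq0 sqrtr1.
rewrite normal_prob_shift ?oner_neq0// dotZ.
rewrite (_ : s^-1 * _ + c = 0); last by rewrite /c; ring.
move=> <-; rewrite /pushforward; congr (P _).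
apply/seteqP; split => x /=; rewrite -/(excess_gain _ _) excess_gainZ /c.
  by congr (A _); ring.
by congr (A _); ring.
Qed.

End portfolios.

(** * Comparison and maximization of expected utility along a ray *)

Section expected_utility_of_portfolios.
Context d (Omega : measurableType d) (R : realType) (P : probability Omega R).
Context (n : nat) (X : 'I_n -> {RV P >-> R}) (mu : 'cV[R]_n) (Sigma : 'M[R]_n).
Context (a b : R).
Hypothesis b0 : 0 < b.
Hypothesis ba : b <= a.
Hypothesis a1 : a <= 1.
Hypothesis iX : forall i, P.-integrable setT (EFin \o X i).
Hypothesis hS : symmetric_posdef Sigma.
Hypothesis hX : multivariate_normal X mu Sigma.
Local Notation gain := (excess_gain X).
Local Notation sd pi := (Num.sqrt (quad Sigma pi)).

Let a0 : 0 < a. Proof. exact: lt_le_trans ba. Qed.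
Let b1 : b <= 1. Proof. exact: le_trans a1. Qed.

Lemma measurable_power_utility (a' b' : R) : 0 < a' -> 0 < b' ->
  measurable_fun setT (power_utility a' b').
Proof. by move=> a'0 b'0; apply: continuous_measurable_fun; exact: continuous_power_utility. Qed.

Lemma integrable_affine (g : Omega -> R) (c k : R) : P.-integrable setT (EFin \o g) ->
  P.-integrable setT (EFin \o (fun x => c + k * g x)).
Proof.
move=> ig.
rewrite (_ : EFin \o _ = (EFin \o cst c) \+ (fun x => k%:E * (EFin \o g) x))%E; last by [].
apply: integrableD => //; first exact: finite_measure_integrable_cst.
exact: integrableZl.
Qed.

Lemma integrable_norm_bound (g : Omega -> R) (c k : R) : P.-integrable setT (EFin \o g) ->
  P.-integrable setT (EFin \o (fun x => c + k * `|g x|)).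
Proof. by move=> ig; apply: integrable_affine; exact: integrable_norm. Qed.

Lemma integrable_power_utility (a' b' : R) (Y : Omega -> R) :
  0 < a' -> a' <= 1 -> 0 < b' -> b' <= 1 -> P.-integrable setT (EFin \o Y) ->
  P.-integrable setT (EFin \o (power_utility a' b' \o Y)).
Proof.
move=> a'0 a'1 b'0 b'1 iY.
apply: (le_integrable _ _ _ (integrable_norm_bound 1 1 iY)) => //.
  apply/measurable_EFinP; apply: measurableT_comp; first exact: measurable_power_utility.
  exact/measurable_EFinP/(measurable_int _ iY).
move=> x _ /=; rewrite lee_fin mul1r [leRHS]ger0_norm ?addr_ge0//.
exact: norm_power_utility_le.
Qed.

Definition expected_gain_utility (c : R) (pi : 'cV[R]_n) : \bar R :=
  (\int[P]_x (power_utility a b (c + gain pi x))%:E)%E.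
Local Notation G := expected_gain_utility.

Lemma integrable_shifted_gain (c : R) pi : P.-integrable setT (EFin \o (fun x => c + gain pi x)).
Proof.
have := integrable_affine c 1 (integrable_excess_gain pi iX).
by under eq_fun do rewrite mul1r.
Qed.

Lemma integrable_gain_utility c pi :
  P.-integrable setT (EFin \o (power_utility a b \o (fun x => c + gain pi x))).
Proof. by apply: integrable_power_utility => //; exact: integrable_shifted_gain. Qed.

Lemma expected_gain_utility_fin c pi : G c pi \is a fin_num.
Proof. apply: integrable_fin_num => //; exact: integrable_gain_utility. Qed.

(* Replacing [pi] by the optimal direction with the same standard deviation raises
   the mean: both wealths are affine images of standard normal variables. *)
Lemma expected_gain_utility_le c pi (S : R) (pis : 'cV[R]_n) :
  quad Sigma pis = 1 -> dot pis mu = S -> dot pi mu <= S * sd pi ->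
  (G c pi <= G c (sd pi *: pis))%E.
Proof.
move=> qpis dpis hle; have [->|pi0] := eqVneq pi 0.
  by rewrite quad0 sqrtr0 scale0r.
set s := sd pi.
have s0 : 0 < s by rewrite sqrtr_gt0 quad_gt0.
have pis0 : pis != 0 by apply: contra_eq_neq qpis => ->; rewrite quad0 eq_sym oner_eq0.
pose Z1 x := (gain pi x - dot pi mu) / s.
pose Z2 x := (gain pis x - dot pis mu) / sd pis.
have N1 : std_normal_law P Z1 by exact: std_normal_law_excess_gain.
have N2 : std_normal_law P Z2 by exact: std_normal_law_excess_gain.
(* [f] sends a standard normal variable to the utility of a wealth with mean [c + S * s] and
   deviation [s]. The portfolio [s *: pis] has such a wealth, and so has [pi] once its wealth is
   raised by [S * s - dot pi mu >= 0]. *)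
pose f z := power_utility a b (c + S * s + s * z).
have f1 x : f (Z1 x) = power_utility a b ((c + (S * s - dot pi mu)) + gain pi x).
  by congr power_utility; rewrite /Z1; field; rewrite gt_eqF.
have f2 x : f (Z2 x) = power_utility a b (c + gain (s *: pis) x).
  by congr power_utility; rewrite /Z2 qpis sqrtr1 divr1 dpis excess_gainZ; ring.
have e : (\int[P]_x (f (Z1 x))%:E = \int[P]_x (f (Z2 x))%:E)%E.
  apply: integral_std_normal_law => //.
  - apply: measurable_funM => //; apply: measurable_funB => //; exact: measurable_excess_gain.
  - apply: measurable_funM => //; apply: measurable_funB => //; exact: measurable_excess_gain.
  - apply: measurableT_comp; first exact: measurable_power_utility.
    by apply: measurable_funD => //; apply: measurable_funM.
  - rewrite (_ : f \o Z1 = power_utility a b \o (fun x => (c + (S * s - dot pi mu)) + gain pi x)).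
      exact: integrable_gain_utility.
    by apply/funext => x; exact: f1.
  - rewrite (_ : f \o Z2 = power_utility a b \o (fun x => c + gain (s *: pis) x)).
      exact: integrable_gain_utility.
    by apply/funext => x; exact: f2.
apply: (@le_trans _ _ (G (c + (S * s - dot pi mu)) pi)).
  have i1 := integrable_gain_utility c pi.
  have i2 := integrable_gain_utility (c + (S * s - dot pi mu)) pi.
  apply: (le_integral measurableT i1 i2) => x _.
  rewrite [leLHS]/= [leRHS]/= lee_fin; apply: (power_utility_homo a0 b0).
  by rewrite lerD2r lerDl subr_ge0.
rewrite le_eqVlt; apply/orP; left; apply/eqP.
transitivity (\int[P]_x (f (Z1 x))%:E)%E.
  by apply: eq_integral => x _; rewrite f1.
by rewrite e; apply: eq_integral => x _; rewrite f2.
Qed.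

(** Extreme value theorem on [[0, B]], for a function of [t] that is continuous by dominated
    convergence. *)
Lemma expected_gain_utility_max c (pis : 'cV[R]_n) (B : R) : 0 <= B ->
  exists2 t, 0 <= t <= B &
    forall t', 0 <= t' <= B -> (G c (t' *: pis) <= G c (t *: pis))%E.
Proof.
move=> B0.
pose f t x := power_utility a b (c + t * gain pis x).
have Gf t : (\int[P]_x f t x)%:E = G c (t *: pis).
  rewrite /Rintegral; have -> : (\int[P]_x (f t x)%:E)%E = G c (t *: pis).
    by apply: eq_integral => x _; rewrite /f excess_gainZ.
  by rewrite fineK// expected_gain_utility_fin.
have ig := integrable_excess_gain pis iX.
(* An open interval around [[0, B]] on which [|t| <= B + 1]; linear growth of the utility then gives
   a bound independent of [t]. *)
have cG : {in `](- 1)%R, (B + 1)[%classic, continuous (fun t => \int[P]_x f t x)}.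
  apply: (@continuity_under_integral R _ Omega P f setT _ (- 1) (B + 1)
     _ _ (fun x => (1 + `|c|) + (B + 1) * `|gain pis x|)) => //.
  - move=> t _; apply: integrable_power_utility => //; exact: integrable_affine.
  - apply: aeW => x _ t _; rewrite /f.
    have h : c + z * gain pis x @[z --> t] --> c + t * gain pis x.
      by apply: cvgD; [exact: cvg_cst|apply: cvgMl; exact: cvg_id].
    exact: (cvg_comp _ _ h (@continuous_power_utility R a b a0 b0 _)).
  - exact: integrable_norm_bound.
  - move=> t /=; rewrite in_itv/= => /andP[t1 tB]; apply: aeW => x _.
    rewrite (le_trans (norm_power_utility_le _ a0 a1 b0 b1))//.
    rewrite -addrA lerD2l (le_trans (ler_normD _ _))// lerD2l normrM ler_wpM2r//.
    by rewrite ler_norml (ltW tB) andbT (le_trans _ (ltW t1))// lerN2 lerDr.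
have [|t tB tmax] := @EVT_max R (fun t => \int[P]_x f t x) 0 B B0.
  apply: continuous_in_subspaceT => t /set_mem/=; rewrite in_itv/= => /andP[t0 tB].
  apply: cG; rewrite inE/= in_itv/=; apply/andP; split.
    by rewrite (lt_le_trans _ t0)// ltrN10.
  by rewrite (le_lt_trans tB)// ltrDl.
exists t; first by move: tB; rewrite in_itv.
move=> t' t'B; rewrite -!Gf lee_fin; apply: tmax; by rewrite in_itv.
Qed.

End expected_utility_of_portfolios.

(** * Divergence of expected utility along the optimal ray *)

Lemma power_utility_incr (R : realType) (a : R) : 0 < a ->
  {homo power_utility a a : x y / x < y}.
Proof.
move=> a0 x y xy; rewrite /power_utility.
have incr (v w : R) : 0 <= v -> v < w -> v `^ a < w `^ a.
  move=> v0 vw; apply: gt0_ltr_powR => //; rewrite nnegrE//.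
  exact: le_trans (ltW vw).
case: (leP 0 x) => x0; case: (leP 0 y) => y0.
- exact: incr.
- by move: (lt_le_trans y0 x0); rewrite ltNge (ltW xy).
- by rewrite (@lt_le_trans _ _ 0)// ?powR_ge0// oppr_lt0 powR_gt0// oppr_gt0.
- by rewrite ltrN2 incr// ?ltrN2// oppr_ge0 ltW.
Qed.

(** If the integral were 0, [f] would vanish outside a null set; positivity would make this null set
    the whole space. *)
Lemma probability_integral_gt0 d (Omega : measurableType d) (R : realType)
    (P : probability Omega R) (f : Omega -> R) :
  P.-integrable setT (EFin \o f) -> (forall x, 0 < f x) ->
  (0 < \int[P]_x (f x)%:E)%E.
Proof.
move=> intf f0; rewrite lt_neqAle; apply/andP; split; last first.
  by apply: integral_ge0 => x _; rewrite lee_fin ltW.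
apply/negP => /eqP h.
have : (\int[P]_x `|(EFin \o f) x| = 0)%E.
  by rewrite [RHS]h; apply: eq_integral => x _; rewrite /= ger0_norm// ltW.
move/(ae_eq_integral_abs P measurableT (measurable_int _ intf)) => [N [mN N0 /= hN]].
have NT : N = setT.
  apply/seteqP; split => // x _; apply: hN => /= /(_ I) [fx].
  by move: (f0 x); rewrite fx ltxx.
by have /eqP := probability_setT P; rewrite -NT N0 eq_sym onee_eq0.
Qed.

Section unbounded.
Context d (Omega : measurableType d) (R : realType) (P : probability Omega R).
Context (n : nat) (X : 'I_n -> {RV P >-> R}) (mu : 'cV[R]_n) (Sigma : 'M[R]_n).
Context (a b : R).
Hypothesis b0 : 0 < b.
Hypothesis ba : b <= a.
Hypothesis a1 : a <= 1.
Hypothesis iX : forall i, P.-integrable setT (EFin \o X i).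
Hypothesis hS : symmetric_posdef Sigma.
Hypothesis hX : multivariate_normal X mu Sigma.
Local Notation gain := (excess_gain X).

Let a0 : 0 < a. Proof. exact: lt_le_trans ba. Qed.

(** The symmetry of the normal law is obtained from the portfolio [- 1 *: pis], which has the
    opposite mean and the same variance. *)
Lemma std_normal_law_centered (pis : 'cV[R]_n) : quad Sigma pis = 1 ->
  let Z := fun x => gain pis x - dot pis mu in
  std_normal_law P Z /\ std_normal_law P (fun x => - Z x).
Proof.
move=> q Z.
have pis0 : pis != 0 by apply: contra_eq_neq q => ->; rewrite quad0 eq_sym oner_eq0.
have N1 : - 1 *: pis != 0 by rewrite scaler_eq0 oppr_eq0 oner_eq0.
split.
  have := std_normal_law_excess_gain hS hX pis0.
  by rewrite q sqrtr1; under eq_fun do rewrite divr1.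
have := std_normal_law_excess_gain hS hX N1.
rewrite quadZ sqrrN expr1n mul1r q sqrtr1 dotZ.
by under eq_fun do rewrite divr1 excess_gainZ -mulrBr mulN1r.
Qed.

(** The gain exceeds its centered version [Z] by the positive constant [S]. The utility is strictly
    increasing, and its expectation at [Z] is 0. *)
Lemma expected_power_utility_gt0 (pis : 'cV[R]_n) :
  quad Sigma pis = 1 -> 0 < dot pis mu ->
  (0 < \int[P]_x (power_utility a a (gain pis x))%:E)%E.
Proof.
move=> q S0; set S := dot pis mu in S0.
have [NZ NZN] := std_normal_law_centered q.
set Z := fun x => _ in NZ NZN.
have iY := integrable_excess_gain pis iX.
have iZ : P.-integrable setT (EFin \o Z).
  have := integrable_affine (- S) 1 iY.
  by under eq_fun do rewrite mul1r addrC.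
have ivY := integrable_power_utility a0 a1 a0 a1 iY.
have ivZ := integrable_power_utility a0 a1 a0 a1 iZ.
have ZE x : power_utility a a (- Z x) = - power_utility a a (Z x).
  exact: power_utilityN.
have iNZ : P.-integrable setT (EFin \o (power_utility a a \o (fun x => - Z x))).
  rewrite (_ : EFin \o _ = (\- (EFin \o (power_utility a a \o Z)))%E).
    exact: integrableN.
  by apply/funext => x /=; rewrite ZE.
have mZ : measurable_fun setT Z by exact/measurable_EFinP/(measurable_int _ iZ).
have mZN : measurable_fun setT (fun x => - Z x) by exact: measurableT_comp.
have mv := measurable_power_utility a0 a0.
(* The utility is odd and [Z], [- Z] have the same law, so this finite integral equals its own
   opposite. *)
have z0 : (\int[P]_x (power_utility a a (Z x))%:E = 0)%E.
  have e := integral_std_normal_law mZ mZN mv NZ NZN ivZ iNZ.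
  have : (\int[P]_x (power_utility a a (- Z x))%:E =
          - \int[P]_x (power_utility a a (Z x))%:E)%E.
    rewrite -integralN/=; last exact: integrable_add_def.
    by apply: eq_integral => x _; rewrite ZE.
  rewrite -e.
  have fin := integrable_fin_num measurableT ivZ.
  rewrite -(fineK fin) => -[h]; congr EFin; lra.
have := @probability_integral_gt0 _ _ _ P
  (fun x => power_utility a a (gain pis x) - power_utility a a (Z x)).
have -> : (\int[P]_x (power_utility a a (gain pis x) - power_utility a a (Z x))%:E =
   \int[P]_x (power_utility a a (gain pis x))%:E)%E.
  under eq_integral do rewrite EFinB.
  by rewrite integralB//= z0 sube0.
apply.
  rewrite (_ : EFin \o _ =
    ((EFin \o (power_utility a a \o gain pis)) \- (EFin \o (power_utility a a \o Z)))%E)//.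
  exact: integrableB.
move=> x; rewrite subr_gt0; apply: (power_utility_incr a0).
by rewrite /Z gtrBl.
Qed.

Lemma expected_gain_utility_unbounded (c A : R) (pis : 'cV[R]_n) : 0 <= c ->
  quad Sigma pis = 1 -> 0 < dot pis mu ->
  exists2 t, 0 <= t & (A%:E <= expected_gain_utility X a b c (t *: pis))%E.
Proof.
move=> c0 q S0.
have := expected_power_utility_gt0 q S0.
have iY := integrable_excess_gain pis iX.
have ivY := integrable_power_utility a0 a1 a0 a1 iY.
have fin := integrable_fin_num measurableT ivY.
rewrite -(fineK fin); set k := fine _; rewrite lte_fin => k0.
pose m := Num.max 0 ((A + 1) / k).
have m0 : 0 <= m by rewrite /m le_max lexx.
exists (m `^ a^-1); first exact: powR_ge0.
set t := _ `^ _; have ta : t `^ a = m.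
  by rewrite /t -powRrM mulVf ?gt_eqF// powRr1.
apply: (@le_trans _ _ (\int[P]_x (- 1 + t `^ a * power_utility a a (gain pis x))%:E)%E).
  under eq_integral do rewrite EFinD EFinM.
  rewrite integralD//=; last 2 first.
  - exact: finite_measure_integrable_cst.
  - exact: (integrableZl _ _ ivY).
  rewrite integral_cst// [X in ((-1)%:E * X + _)%E](_ : _ = 1%E); last exact: probability_setT.
  rewrite mule1 integralZl// -(fineK fin) -/k.
  rewrite -EFinM -EFinD lee_fin ta.
  have : (A + 1) / k <= m by rewrite /m le_max lexx orbT.
  by rewrite ler_pdivrMr// => h; lra.
have t0 : 0 <= t by exact: powR_ge0.
apply: le_integral => //.
- exact: (integrable_affine _ _ ivY).
- exact: (integrable_gain_utility b0 ba a1 iX _ _).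
(* Homogeneity moves [t] inside the odd utility, passing to exponent [b] on losses costs at most 1,
   and adding [c >= 0] only helps. *)
move=> x _; rewrite /= lee_fin -power_utilityZ// excess_gainZ addrC.
rewrite (le_trans (power_utility_ge _ b0 ba))//.
by apply: power_utility_homo => //; rewrite lerDr.
Qed.

End unbounded.

(** * Well-posedness *)

Section well_posedness.
Context d (Omega : measurableType d) (R : realType) (P : probability Omega R).
Context (n : nat) (X : 'I_n -> {RV P >-> R}) (mu : 'cV[R]_n) (Sigma : 'M[R]_n).
Context (a b r : R) (S0 : 'I_n.+1 -> R) (S1 : 'I_n.+1 -> {RV P >-> R}).
Hypothesis n0 : (0 < n)%N.
Hypothesis b0 : 0 < b.
Hypothesis ba : b <= a.
Hypothesis a1 : a <= 1.
Hypothesis r1 : -1 < r.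
Hypothesis iX : forall i, P.-integrable setT (EFin \o X i).
Hypothesis hS : symmetric_posdef Sigma.
Hypothesis hX : multivariate_normal X mu Sigma.
Hypothesis hS0 : forall i, S0 i = 1.
Hypothesis hS1riskless : forall x, S1 ord0 x = 1 + r.
Hypothesis hS1risky : forall (i : 'I_n) x, S1 (lift ord0 i) x = 1 + r + X i x.
Local Notation gain := (excess_gain X).
Local Notation sd pi := (Num.sqrt (quad Sigma pi)).
Local Notation G := (expected_gain_utility X a b).
Local Notation u := (power_utility a b).

Let a0 : 0 < a. Proof. exact: lt_le_trans ba. Qed.

Definition risky_part (theta : 'cV[R]_n.+1) : 'cV[R]_n :=
  \col_i theta (lift ord0 i) 0.

(** A section of [risky_part] with prescribed budget [w]: the riskless position is the residual, so
    the risky part can be chosen freely. *)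
Definition self_financing (w : R) (pi : 'cV[R]_n) : 'cV[R]_n.+1 :=
  \col_i if unlift ord0 i is Some j then pi j 0 else w - \sum_(j < n) pi j 0.

Lemma risky_part_self_financing w pi : risky_part (self_financing w pi) = pi.
Proof. by apply/matrixP => i j; rewrite !mxE liftK (ord1 j). Qed.

Lemma initial_wealth_self_financing w pi :
  initial_wealth S0 (self_financing w pi) = w.
Proof.
rewrite /initial_wealth big_ord_recl !mxE unlift_none hS0 mulr1.
have e j : self_financing w pi (lift ord0 j) 0 * S0 (lift ord0 j) = pi j 0.
  by rewrite mxE liftK hS0 mulr1.
by rewrite [X in _ + X](eq_bigr (fun j => pi j 0)) ?subrK// => j _; exact: e.
Qed.

Lemma terminal_wealthE theta :
  terminal_wealth S1 theta =
  fun x => initial_wealth S0 theta * (1 + r) + gain (risky_part theta) x.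
Proof.
apply/funext => x; rewrite /terminal_wealth /initial_wealth /excess_gain.
rewrite !big_ord_recl hS1riskless hS0 mulr1 mulrDl -addrA; congr (_ + _).
rewrite mulr_suml -big_split/=; apply: eq_bigr => i _.
by rewrite hS1risky hS0 mxE mulr1 mulrDr.
Qed.

(** VaR and ES enter the argument only through the following properties, so both are treated at
    once. *)
Variables (risk : (Omega -> R) -> R) (kappa : R).
Hypothesis kappa0 : 0 < kappa.
Hypothesis riskE : forall (c : R) (pi : 'cV[R]_n),
  risk (fun x => c + gain pi x) = - c - dot pi mu + kappa * sd pi.
Hypothesis risk_cst : forall c : R, risk (cst c) = - c.

Lemma expected_utility_terminal_wealth theta :
  expected_utility P u (terminal_wealth S1 theta) =
  G (initial_wealth S0 theta * (1 + r)) (risky_part theta).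
Proof. by rewrite /expected_utility unlock terminal_wealthE. Qed.

Lemma maximizer_of_SRmax_lt (w Rmax : R) : 0 < w ->
  risk (cst (w * (1 + r))) <= Rmax -> SRmax mu Sigma < kappa ->
  exists2 theta, admissible S0 S1 risk w Rmax theta &
    forall theta', admissible S0 S1 risk w Rmax theta' ->
      (expected_utility P u (terminal_wealth S1 theta') <=
       expected_utility P u (terminal_wealth S1 theta))%E.
Proof.
rewrite risk_cst => w0 hR; set S := SRmax mu Sigma => Sk.
have SE : S = Num.sqrt (quad (invmx Sigma) mu) by exact: SRmaxE.
have [pis qs ds] := max_sharpe_portfolio mu n0 hS.
rewrite -SE in ds.
set W := w * (1 + r) in hR.
(* At deviation [t] on the optimal ray the risk is [- W + (kappa - S) * t], which is at most [Rmax]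
   exactly when [t <= B]. Admissibility of the riskless investment gives [B >= 0]. *)
pose B := (Rmax + W) / (kappa - S).
have kS : 0 < kappa - S by rewrite subr_gt0.
have B0 : 0 <= B by rewrite /B divr_ge0 ?(ltW kS)// -lerBlDr sub0r.
have [t tB tmax] := expected_gain_utility_max b0 ba a1 iX W pis B0.
have /andP[t0 tleB] := tB.
exists (self_financing w (t *: pis)).
  split; first exact: initial_wealth_self_financing.
  rewrite terminal_wealthE initial_wealth_self_financing risky_part_self_financing -/W.
  rewrite riskE sqrt_quadZ// qs sqrtr1 dotZ ds.
  move: tleB; rewrite /B ler_pdivlMr// => h; lra.
move=> theta' [hw].
rewrite {1}terminal_wealthE hw -/W riskE => hrisk.
rewrite !expected_utility_terminal_wealth hw initial_wealth_self_financing.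
rewrite risky_part_self_financing -/W.
set pi := risky_part theta' in hrisk *.
have hsr : dot pi mu <= S * sd pi by rewrite SE; exact: sharpe_ratio_le.
apply: (le_trans (expected_gain_utility_le b0 ba a1 iX hS hX W qs ds hsr)).
(* The risk constraint and [dot pi mu <= S * sd pi] give [(kappa - S) * sd pi <= Rmax + W], so the
   comparison point also lies in [[0, B]]. *)
apply: tmax; rewrite sqrtr_ge0/= /B ler_pdivlMr//; lra.
Qed.

Lemma unbounded_of_SRmax_ge (A w Rmax : R) : 0 < w ->
  risk (cst (w * (1 + r))) <= Rmax -> kappa <= SRmax mu Sigma ->
  exists2 theta, admissible S0 S1 risk w Rmax theta &
    (A%:E <= expected_utility P u (terminal_wealth S1 theta))%E.
Proof.
rewrite risk_cst => w0 hR; set S := SRmax mu Sigma => Sk.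
have SE : S = Num.sqrt (quad (invmx Sigma) mu) by exact: SRmaxE.
have [pis qs ds] := max_sharpe_portfolio mu n0 hS.
rewrite -SE in ds.
set W := w * (1 + r) in hR.
have W0 : 0 <= W by rewrite /W mulr_ge0 ?(ltW w0)// -lerBlDl sub0r ltW.
have S0' : 0 < dot pis mu by rewrite ds (lt_le_trans kappa0).
have [t t0 ht] := expected_gain_utility_unbounded b0 ba a1 iX hS hX A W0 qs S0'.
exists (self_financing w (t *: pis)).
  split; first exact: initial_wealth_self_financing.
  rewrite terminal_wealthE initial_wealth_self_financing risky_part_self_financing -/W.
  rewrite riskE sqrt_quadZ// qs sqrtr1 dotZ ds.
  (* Hence the risk on the ray, [- W - t * S + kappa * t], never exceeds that of the riskless
     investment. *)
  have : t * kappa <= t * S by exact: ler_wpM2l.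
  by move=> tk; apply: le_trans hR; rewrite -addrA gerDl addrC subr_le0 mulr1 mulrC.
by rewrite expected_utility_terminal_wealth initial_wealth_self_financing risky_part_self_financing.
Qed.

Lemma expected_utility_fin theta :
  expected_utility P u (terminal_wealth S1 theta) \is a fin_num.
Proof.
rewrite expected_utility_terminal_wealth.
exact: (expected_gain_utility_fin b0 ba a1 iX _ _).
Qed.

(** Failure is tested at [w = 1] with the smallest allowed [Rmax]: unbounded utilities beat any
    candidate maximizer by 1 and make the supremum infinite. Conversely, a maximizer has finite
    expected utility, while the utility at infinity is infinite. *)
Lemma well_posed_iff :
  (well_posed r S0 S1 u risk <-> SRmax mu Sigma < kappa) /\
  (weakly_well_posed r S0 S1 u risk <-> SRmax mu Sigma < kappa).
Proof.
split; split.
- move=> h; rewrite ltNge; apply/negP => Sk.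
  have [theta _ hmax] := h 1 _ ltr01 (lexx _).
  have fin := expected_utility_fin theta.
  have [theta' hadm] := unbounded_of_SRmax_ge
    (fine (expected_utility P u (terminal_wealth S1 theta)) + 1)
    ltr01 (lexx _) Sk.
  move=> /le_trans/(_ (hmax _ hadm)).
  by rewrite -{2}(fineK fin) lee_fin gerDl ler10.
- by move=> Sk w Rmax w0 hR; exact: maximizer_of_SRmax_lt.
- move=> h; rewrite ltNge; apply/negP => Sk.
  have := h 1 _ ltr01 (lexx _).
  rewrite (_ : ereal_sup _ = +oo%E) ?ltNge ?leey//.
  apply/eqyP => A _.
  have [theta' hadm hA] := unbounded_of_SRmax_ge A ltr01 (lexx _) Sk.
  by apply: (le_trans hA); apply: ereal_sup_ubound; exists theta'.
- move=> Sk w Rmax w0 hR.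
  have [theta hadm hmax] := maximizer_of_SRmax_lt w0 hR Sk.
  rewrite (utility_at_infinity_power _ a0).
  have fin := expected_utility_fin theta.
  apply: (@le_lt_trans _ _ (expected_utility P u (terminal_wealth S1 theta))).
    by apply: ge_ereal_sup => _ [theta' h' <-]; exact: hmax.
  by rewrite -(fineK fin) ltry.
Qed.

End well_posedness.

(** * Risk of portfolio wealth *)

Section risk_of_portfolios.
Context d (Omega : measurableType d) (R : realType) (P : probability Omega R).
Context (n : nat) (X : 'I_n -> {RV P >-> R}) (mu : 'cV[R]_n) (Sigma : 'M[R]_n).
Hypothesis hS : symmetric_posdef Sigma.
Hypothesis hX : multivariate_normal X mu Sigma.

Lemma std_normal_law_wealth (c : R) (pi : 'cV[R]_n) : pi != 0 ->
  std_normal_law P (fun x =>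
    (c + excess_gain X pi x - (c + dot pi mu)) / Num.sqrt (quad Sigma pi)).
Proof.
move=> /(std_normal_law_excess_gain hS hX).
rewrite (_ : (fun x => (excess_gain X pi x - dot pi mu) / Num.sqrt (quad Sigma pi)) =
  (fun x => (c + excess_gain X pi x - (c + dot pi mu)) / Num.sqrt (quad Sigma pi)))//.
by apply/funext => x; congr (_ / _); ring.
Qed.

Lemma excess_gain0E (c : R) : (fun x => c + excess_gain X 0 x) = cst c.
Proof. by apply/funext => x; rewrite excess_gain0 addr0. Qed.

Lemma VaR_wealth (alpha c : R) (pi : 'cV[R]_n) : 0 < alpha < 1 ->
  VaR P alpha (fun x => c + excess_gain X pi x) =
  - c - dot pi mu + - std_normal_cdf_inv alpha * Num.sqrt (quad Sigma pi).
Proof.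
(* The zero portfolio has deviation 0 and cannot be standardized; its wealth is constant. *)
move=> alpha01; have [->|pi0] := eqVneq pi 0.
  by rewrite excess_gain0E VaR_cst// quad0 sqrtr0 mulr0 /dot trmx0 mul0mx mxE subr0 addr0.
rewrite (VaR_normal (m := c + dot pi mu) (s := Num.sqrt (quad Sigma pi)))//.
- by ring.
- by rewrite sqrtr_gt0 quad_gt0.
- exact: std_normal_law_wealth.
Qed.

Lemma ES_wealth (alpha c : R) (pi : 'cV[R]_n) : 0 < alpha < 1 ->
  ES P alpha (fun x => c + excess_gain X pi x) =
  - c - dot pi mu +
    std_normal_pdf (std_normal_cdf_inv alpha) / alpha * Num.sqrt (quad Sigma pi).
Proof.
move=> alpha01; have [->|pi0] := eqVneq pi 0.
  by rewrite excess_gain0E ES_cst// quad0 sqrtr0 mulr0 /dot trmx0 mul0mx mxE subr0 addr0.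
rewrite (ES_normal (m := c + dot pi mu) (s := Num.sqrt (quad Sigma pi)))//.
- by rewrite opprD [X in _ + X]mulrC.
- by rewrite sqrtr_gt0 quad_gt0.
- exact: std_normal_law_wealth.
Qed.

(** [Phi] increases and [Phi 0 = 2^-1]; the symmetric variable behind this value is the centered
    gain of a unit-variance portfolio, which exists since [n > 0]. *)
Lemma std_normal_cdf_inv_lt0 (alpha : R) : (0 < n)%N ->
  (forall i, P.-integrable setT (EFin \o X i)) ->
  0 < alpha -> alpha < 2^-1 -> std_normal_cdf_inv alpha < 0.
Proof.
move=> n0 iX alpha0 alpha2.
have alpha01 : 0 < alpha < 1 by rewrite alpha0 (lt_trans alpha2)// invf_lt1// ltr1n.
have [pis qs _] := max_sharpe_portfolio mu n0 hS.
have [NZ NZN] := std_normal_law_centered hS hX qs.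
have half := std_normal_cdf0 _ NZ NZN.
rewrite ltNge -std_normal_cdf_mono std_normal_cdf_invK// half -?ltNge//.
by apply: measurable_funB => //; exact: measurable_excess_gain.
Qed.

End risk_of_portfolios.

Unset Implicit Arguments.
Set Strict Implicit.

Theorem corollary6p10 (disp : measure_display) (Omega : measurableType disp)
    (R : realType) (P : probability Omega R) (hP : atomless P)
    (L : set {RV P >-> R}) (hLriesz : riesz_space L)
    (hLbetween : between_Linfty_L1 L) (hLlaw : law_invariant L)
    (d : nat) (hd : (0 < d)%N) (mu : 'cV[R]_d) (Sigma : 'M[R]_d)
    (hSigma : symmetric_posdef Sigma)
    (X : 'I_d -> {RV P >-> R}) (hX : multivariate_normal X mu Sigma)
    (hXL : forall i, L (X i))
    (r : R) (hr : -1 < r)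
    (S0 : 'I_d.+1 -> R) (S1 : 'I_d.+1 -> {RV P >-> R})
    (hS0 : forall i, S0 i = 1)
    (hS1riskless : forall x, S1 ord0 x = 1 + r)
    (hS1risky : forall (i : 'I_d) x, S1 (lift ord0 i) x = 1 + r + X i x)
    (a b : R) (hb : 0 < b) (hba : b <= a) (ha : a <= 1) :
  let u := power_utility a b in
  [/\ SRmax mu Sigma = Num.sqrt (quad (invmx Sigma) mu),
      forall alpha : R, 0 < alpha -> alpha < 2^-1 ->
        (well_posed r S0 S1 u (VaR P alpha) <->
           SRmax mu Sigma < - std_normal_cdf_inv alpha) /\
        (weakly_well_posed r S0 S1 u (VaR P alpha) <->
           SRmax mu Sigma < - std_normal_cdf_inv alpha)
    & forall alpha : R, 0 < alpha -> alpha < 1 ->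
        (well_posed r S0 S1 u (ES P alpha) <->
           SRmax mu Sigma <
             std_normal_pdf (std_normal_cdf_inv alpha) / alpha) /\
        (weakly_well_posed r S0 S1 u (ES P alpha) <->
           SRmax mu Sigma <
             std_normal_pdf (std_normal_cdf_inv alpha) / alpha)].
Proof.
move=> u.
have iX i : P.-integrable setT (EFin \o X i).
  by apply/Lfun1_integrable; exact: hLbetween.2 (hXL i).
have a0 : 0 < a := lt_le_trans hb hba.
split.
- exact: SRmaxE.
- move=> alpha alpha0 alpha2.
  have alpha01 : 0 < alpha < 1 by rewrite alpha0 (lt_trans alpha2)// invf_lt1// ltr1n.
  apply: (well_posed_iff hd hb hba ha hr iX hSigma hX hS0 hS1riskless hS1risky).
  (* The restriction [alpha < 2^-1] makes the coefficient of the deviation in VaR positive. *)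
  + by rewrite oppr_gt0; exact: (std_normal_cdf_inv_lt0 hSigma hX hd).
  + by move=> c pi; exact: VaR_wealth.
  + by move=> c; exact: VaR_cst.
- move=> alpha alpha0 alpha1; have alpha01 : 0 < alpha < 1 by rewrite alpha0.
  apply: (well_posed_iff hd hb hba ha hr iX hSigma hX hS0 hS1riskless hS1risky).
  + by rewrite divr_gt0// std_normal_pdf_gt0.
  + by move=> c pi; exact: ES_wealth.
  + by move=> c; exact: ES_cst.
Qed.
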